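(* Let $\mathcal{D}$ be an elementary absorbing set with all variable nodes of degree $3$, with routing matrix $\mathbf{A}$ and repetition matrix $\mathbf{R}$, and let $\tau$ be the solution of either of the two optimization problems $$\tau'=\max\{\min(\boldsymbol\lambda): \boldsymbol\lambda\in\mathbb{R}^a,\ -\mathbf{1}\le\mathbf{x}\le\mathbf{1},\ \exists j: x_j<1,\ \mathbf{x}=\mathrm{sat}(\mathbf{A}(\mathbf{x}-\mathbf{1})+2\cdot\mathbf{1}+\mathbf{R}\boldsymbol\lambda)\},$$ $$\tau^*=\max\{\min(\boldsymbol\lambda): \boldsymbol\lambda\in\mathbb{R}^N,\ -\mathbf{1}\le\mathbf{x}\le\mathbf{1},\ \exists j: x_j<1,\ \mathbf{x}=\mathrm{sat}(\mathbf{A}(\mathbf{x}-\mathbf{1})+2\cdot\mathbf{1}+\boldsymbol\lambda)\}$$ (i.e. $\tau=\tau'$ or $\tau=\tau^*$). Let $\boldsymbol\lambda\in\mathbb{R}^a$ with $\boldsymbol\lambda>\tau\cdot\mathbf{1}$ (entrywise strict). Then for every starting point $\mathbf{x}^{(0)}\in\mathbb{R}^N$ with $-\mathbf{1}\le\mathbf{x}^{(0)}\le\mathbf{1}$, the sequence defined by $$\mathbf{x}^{(k+1)}=\mathrm{sat}\left(\mathbf{A}(\mathbf{x}^{(k)}-\mathbf{1})+2\cdot\mathbf{1}+\mathbf{R}\boldsymbol\lambda\right)$$ satisfies, for some sufficiently large $K\ge 0$, $\mathbf{x}^{(k)}=\mathbf{1}$ for all $k\ge K$.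
   Context: Setting. Consider a Tanner graph (bipartite graph with variable nodes, VNs, and check nodes, CNs) in which every VN has degree 3. Let $\mathcal{D}$ be a nonempty finite set of VNs. Let $\mathcal{E}(\mathcal{D})$ and $\mathcal{O}(\mathcal{D})$ be the sets of CNs adjacent to $\mathcal{D}$ that are connected to $\mathcal{D}$ an even, respectively odd, number of times. $\mathcal{D}$ is an absorbing set $(a,b)$ if $|\mathcal{D}|=a$, $|\mathcal{O}(\mathcal{D})|=b$, and every VN in $\mathcal{D}$ has strictly more neighbors in $\mathcal{E}(\mathcal{D})$ than in $\mathcal{O}(\mathcal{D})$. It is elementary if every CN is connected to $\mathcal{D}$ at most twice; then each CN in $\mathcal{E}(\mathcal{D})$ has exactly two neighbors in $\mathcal{D}$, and each CN in $\mathcal{O}(\mathcal{D})$ exactly one. Messages. Let $N=2|\mathcal{E}(\mathcal{D})|$. The $N$ internal messages are indexed by pairs $(v,c)$ with $v\in\mathcal{D}$, $c\in\mathcal{E}(\mathcal{D})$, $v$ adjacent to $c$ (the message from $v$ to $c$); enumerate them as $1,\dots,N$. The routing matrix $\mathbf{A}\in\{0,1\}^{N\times N}$ has $A_{(v,c),(v',c')}=1$ iff $v'\ne v$, $c'$ is adjacent to both $v'$ and $v$, and $c\ne c'$ (message $(v',c')$ is forwarded by $c'$ to $v$ and contributes to the message of $v$ to $c$); otherwise the entry is $0$. The repetition matrix $\mathbf{R}\in\{0,1\}^{N\times a}$ has $R_{(v,c),w}=1$ iff $v=w$. Notation. $\mathbf{1}$ is the all-ones vector; vector inequalities are entrywise;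 $\min(\boldsymbol\lambda)$ is the smallest entry; $\mathrm{sat}(x)=\mathrm{sign}(x)\min(|x|,1)$, applied entrywise to vectors. *)

(* Defs.v *)
From mathcomp Require Import all_boot all_order all_algebra.
From mathcomp Require Import finmap.
From mathcomp Require Import boolp classical_sets reals.

Set Implicit Arguments.
Unset Strict Implicit.
Unset Printing Implicit Defensive.

Import Order.TTheory GRing.Theory Num.Theory.
Local Open Scope fset_scope.
Local Open Scope ring_scope.

(* A Tanner graph is given by its variable nodes V, its check nodes C and the
   finite neighbourhood nbr v of every variable node v; c and v are adjacent
   iff c \in nbr v.  V and C may be infinite. *)

Definition connections (V C : choiceType) (nbr : V -> {fset C}) (D : {fset V})
    (c : C) : nat :=
  #|` [fset v in D | c \in nbr v]|.

Definition adjacentCN (V C : choiceType) (nbr : V -> {fset C})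
    (D : {fset V}) : {fset C} :=
  \bigcup_(v <- D) nbr v.

Definition evenCN (V C : choiceType) (nbr : V -> {fset C})
    (D : {fset V}) : {fset C} :=
  [fset c in adjacentCN nbr D | ~~ odd (connections nbr D c)].

Definition oddCN (V C : choiceType) (nbr : V -> {fset C})
    (D : {fset V}) : {fset C} :=
  [fset c in adjacentCN nbr D | odd (connections nbr D c)].

Definition absorbing_set (V C : choiceType) (nbr : V -> {fset C})
    (D : {fset V}) (a b : nat) : Prop :=
  [/\ D != fset0, #|` D| = a, #|` oddCN nbr D| = b &
      forall v, v \in D ->
        (#|` nbr v `&` oddCN nbr D| < #|` nbr v `&` evenCN nbr D|)%N].

Definition elementary (V C : choiceType) (nbr : V -> {fset C})
    (D : {fset V}) : Prop :=
  forall c : C, (connections nbr D c <= 2)%N.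

(* (v, c) is the message from v to c. *)
Definition internal_message (V C : choiceType) (nbr : V -> {fset C})
    (D : {fset V}) (p : V * C) : bool :=
  [&& p.1 \in D, p.2 \in evenCN nbr D & p.2 \in nbr p.1].

Definition enumerates (T : Type) (n : nat) (f : 'I_n -> T) (P : T -> bool) :
    Prop :=
  injective f /\ forall t : T, P t <-> exists i : 'I_n, f i = t.

Definition routing_mx (R : realType) (V C : choiceType) (nbr : V -> {fset C})
    (n : nat) (msg : 'I_n -> V * C) : 'M[R]_n :=
  \matrix_(i < n, j < n)
    [&& (msg j).1 != (msg i).1, (msg j).2 \in nbr (msg j).1,
        (msg j).2 \in nbr (msg i).1 & (msg i).2 != (msg j).2]%:R.

Definition repetition_mx (R : realType) (V C : choiceType) (n a : nat)
    (msg : 'I_n -> V * C) (vn : 'I_a -> V) : 'M[R]_(n, a) :=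
  \matrix_(i < n, w < a) ((msg i).1 == vn w)%:R.

Definition sat (R : realType) (x : R) : R := Num.sg x * Num.min `|x| 1.

Definition update (R : realType) (n : nat) (A : 'M[R]_n) (u x : 'cV[R]_n) :
    'cV[R]_n :=
  map_mx (@sat R) (A *m (x - const_mx 1) + 2 *: const_mx 1 + u).

Definition in_unit_box (R : realType) (n : nat) (x : 'cV[R]_n) : Prop :=
  forall i : 'I_n, -1 <= x i 0 <= 1.

Definition smallest_entry (R : realType) (m : nat) (lambda : 'cV[R]_m)
    (t : R) : Prop :=
  (exists i : 'I_m, lambda i 0 = t) /\ forall i : 'I_m, t <= lambda i 0.

(* Objective values min(lambda) over the feasible pairs (lambda, x), where
   lambda enters the fixed-point equation through L : R^m -> R^n. *)
Definition objective_values (R : realType) (n m : nat) (A : 'M[R]_n)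
    (L : 'cV[R]_m -> 'cV[R]_n) : set R :=
  [set t | exists (lambda : 'cV[R]_m) (x : 'cV[R]_n),
     [/\ smallest_entry lambda t, in_unit_box x,
         exists j : 'I_n, x j 0 < 1 & x = update A (L lambda) x]]%classic.

Definition is_max (R : realType) (S : set R) (t : R) : Prop :=
  S t /\ ubound S t.

(* Main.v *)
Require Import Defs.
From mathcomp Require Import all_boot all_order all_algebra.
From mathcomp Require Import finmap.
From mathcomp Require Import boolp classical_sets reals.
From mathcomp Require Import zify lra.

Set Implicit Arguments.
Unset Strict Implicit.
Unset Printing Implicit Defensive.

Import Order.TTheory GRing.Theory Num.Theory.
Local Open Scope fset_scope.
Local Open Scope ring_scope.

(** The update map is monotone and Lipschitz, so the
    orbit of the constant vector [-1] increases to a fixed point and stays below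
    every other orbit.  Since [lambda] exceeds the optimum [tau], that fixed
    point must be the constant vector [1].  Every row of [A] sums to at least
    [1], so [-1] is a fixed point for the weights [lambda = -1]; hence
    [tau >= -1], and [lambda > -1] makes the update map constantly [1] near [1],
    which turns convergence into equality after finitely many steps. *)

(** * The saturation function *)

Section Saturation.

Variable R : realType.
Implicit Types s t e : R.

Lemma sat_cases s :
  [\/ s <= -1 /\ sat s = -1, -1 <= s <= 1 /\ sat s = s | 1 <= s /\ sat s = 1].
Proof.
rewrite /sat; case: (ltrgt0P s) => [s_gt0|s_lt0|->].
- rewrite gtr0_sg // mul1r; case: (leP s 1) => s1.
    by constructor 2; split=> //; apply/andP; split=> //; lra.
  by constructor 3; split=> //; apply: ltW.
- rewrite ltr0_sg // mulN1r; case: (leP (- s) 1) => s1.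
    by constructor 2; rewrite opprK; split=> //; apply/andP; split; lra.
  by constructor 1; split=> //; lra.
- by constructor 2; rewrite sgr0 mul0r lerN10 ler01.
Qed.

Lemma sat_bound s : -1 <= sat s <= 1.
Proof. by case: (sat_cases s) => -[? ->] //; lra. Qed.

(** Monotonicity (take [e = 0]) and the Lipschitz bound with constant 1 in a single one-sided
    estimate. *)
Lemma sat_leD s t e : 0 <= e -> s <= t + e -> sat s <= sat t + e.
Proof.
by move=> ? ?; case: (sat_cases s) => -[? ->]; case: (sat_cases t) => -[? ->]; lra.
Qed.

Lemma le_sat s t : s <= t -> sat s <= sat t.
Proof. by move=> st; have := @sat_leD s t 0; rewrite !addr0; apply. Qed.

Lemma sat_eq1 s : 1 <= s -> sat s = 1.
Proof. by move=> ?; case: (sat_cases s) => -[? ->]; lra. Qed.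

Lemma sat_eqN1 s : s <= -1 -> sat s = -1.
Proof. by move=> ?; case: (sat_cases s) => -[? ->]; lra. Qed.

End Saturation.

Lemma eventually_forall_ord (n : nat) (P : 'I_n -> nat -> Prop) :
  (forall i, exists K, forall k, (K <= k)%N -> P i k) ->
  exists K, forall k, (K <= k)%N -> forall i, P i k.
Proof.
move=> /choice[K KP]; exists (\max_i K i) => k Kk i.
by apply: KP; apply: leq_trans Kk; apply: leq_bigmax.
Qed.

Lemma smallest_entry_exists (R : realType) (m : nat) (l : 'cV[R]_m) (i0 : 'I_m) :
  exists t, smallest_entry l t.
Proof.
case: (Order.TotalTheory.arg_minP (fun i => l i 0) (erefl : xpredT i0)) => i _ li.
by exists (l i 0); split=> [|j]; [exists i | apply: li].
Qed.

Lemma in_unit_box_const (R : realType) (n : nat) (c : R) :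
  -1 <= c <= 1 -> in_unit_box (const_mx c : 'cV[R]_n).
Proof. by move=> c_box i; rewrite mxE. Qed.

(** * Iteration of a saturated affine map with nonnegative coefficients *)

Section MonotoneIteration.

Variables (R : realType) (n : nat) (A : 'M[R]_n) (u : 'cV[R]_n).
Hypothesis A_ge0 : forall i j, 0 <= A i j.
Implicit Types x y : 'cV[R]_n.

(** A crude common bound on the row sums, hence a Lipschitz constant for the update. The summand 1
    keeps it positive, so one may divide by it. *)
Let M : R := 1 + \sum_i \sum_j A i j.

Let M_gt0 : 0 < M.
Proof.
by apply: ltr_pwDl => //; apply: sumr_ge0 => i _; apply: sumr_ge0.
Qed.

Let row_sum_le i : \sum_j A i j <= M.
Proof.
rewrite /M [in leRHS](bigD1 i) //= addrCA lerDl addr_ge0 //.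
by apply: sumr_ge0 => k _; apply: sumr_ge0.
Qed.

Lemma updateE x i :
  update A u x i 0 = sat (\sum_j A i j * (x j 0 - 1) + 2 + u i 0).
Proof.
rewrite !mxE mulr1; congr (sat (_ + _ + _)).
by apply: eq_bigr => j _; rewrite !mxE.
Qed.

Lemma update_box x : in_unit_box (update A u x).
Proof. by move=> i; rewrite updateE sat_bound. Qed.

Lemma le_update x y : (forall i, x i 0 <= y i 0) ->
  forall i, update A u x i 0 <= update A u y i 0.
Proof.
move=> xy i; rewrite !updateE; apply: le_sat.
rewrite -!addrA lerD2r; apply: ler_sum => j _.
by apply: ler_wpM2l => //; rewrite lerD2r.
Qed.

Let mul_le x y e i : 0 <= e -> (forall j, x j 0 <= y j 0 + e) ->
  \sum_j A i j * (x j 0 - 1) <= \sum_j A i j * (y j 0 - 1) + M * e.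
Proof.
move=> e_ge0 xy.
apply: (@le_trans _ _ (\sum_j (A i j * (y j 0 - 1) + A i j * e))).
  apply: ler_sum => j _; rewrite -mulrDr; apply: ler_wpM2l => //.
  by have := xy j; lra.
by rewrite big_split /= lerD2l -mulr_suml ler_wpM2r.
Qed.

Let y (k : nat) : 'cV[R]_n := iter k (update A u) (const_mx (-1)).

Let y_box k : in_unit_box (y k).
Proof.
case: k => [|k]; last exact: update_box.
by apply: in_unit_box_const; rewrite lexx /=; lra.
Qed.

Let y_leS k i : y k i 0 <= y k.+1 i 0.
Proof.
elim: k i => [|k IHk] i; last exact: le_update.
by rewrite [leLHS]mxE; have /andP[] := y_box 1 i.
Qed.

Let y_le k l i : (k <= l)%N -> y k i 0 <= y l i 0.
Proof.
move=> /subnK <-; elim: (l - k)%N => [|d IHd] //.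
by rewrite addSn; apply: le_trans IHd _.
Qed.

Let ysup : 'cV[R]_n := \col_i sup (range (fun k => y k i 0))%classic.

Let y_has_sup i : has_sup (range (fun k => y k i 0))%classic.
Proof.
split; first by exists (y 0 i 0), 0%N.
by exists 1 => _ [k _ <-]; have /andP[] := y_box k i.
Qed.

Let y_le_ysup k i : y k i 0 <= ysup i 0.
Proof.
by rewrite [leRHS]mxE; apply: sup_upper_bound => //; exists k.
Qed.

(** Convergence to the entrywise supremum is uniform in [i] because there are finitely many
    coordinates. *)
Let ysup_approx e : 0 < e ->
  exists K, forall k, (K <= k)%N -> forall i, ysup i 0 <= y k i 0 + e.
Proof.
move=> e_gt0; apply: eventually_forall_ord => i.
have [_ [K _ <-] ltK] := sup_adherent e_gt0 (y_has_sup i).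
exists K => k Kk; have := y_le i Kk; rewrite [X in X <= _ + e]mxE; lra.
Qed.

Let ysup_box : in_unit_box ysup.
Proof.
move=> i; apply/andP; split.
  by apply: le_trans (y_le_ysup 0 i); have /andP[] := y_box 0 i.
rewrite mxE; apply: ge_sup; first by case: (y_has_sup i).
by move=> _ [k _ <-]; have /andP[] := y_box k i.
Qed.

Let ysup_fixed : ysup = update A u ysup.
Proof.
apply/colP => i; apply/eqP; rewrite eq_le; apply/andP; split.
  (* By monotonicity every iterate lies below the image of [ysup], and so does their supremum. *)
  rewrite [leLHS]mxE; apply: ge_sup; first by case: (y_has_sup i).
  move=> _ [k _ <-]; apply: le_trans (y_leS k i) _.
  by apply: le_update => j; apply: y_le_ysup.
(* Conversely, if [y K] is within [e / M] of [ysup], then the image of [ysup] exceeds [y K.+1], and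
   hence [ysup], by at most [e]. *)
apply/ler_addgt0Pr => e e_gt0.
have eM_gt0 : 0 < e / M by rewrite divr_gt0.
have [K /(_ K (leqnn K)) ysupK] := ysup_approx eM_gt0.
apply: le_trans (_ : y K.+1 i 0 + e <= _); last by rewrite lerD2r.
rewrite /= !updateE; apply: sat_leD; first exact: ltW.
have := mul_le i (ltW eM_gt0) ysupK.
rewrite mulrCA divff ?mulr1 ?gt_eqF //; lra.
Qed.

Lemma iterates_eventually_one (x : nat -> 'cV[R]_n) :
  (forall i, -1 < u i 0) ->
  (forall z, in_unit_box z -> z = update A u z -> forall i, 1 <= z i 0) ->
  in_unit_box (x 0%N) -> (forall k, x k.+1 = update A u (x k)) ->
  exists K, forall k, (K <= k)%N -> x k = const_mx 1.
Proof.
move=> u_gt only1 x0_box x_rec.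
have ysup_ge1 := only1 _ ysup_box ysup_fixed.
have y_le_x k i : y k i 0 <= x k i 0.
  elim: k i => [|k IHk] i; last by rewrite x_rec; apply: le_update.
  by rewrite mxE; have /andP[] := x0_box i.
suff [K KP] : exists K, forall k, (K <= k)%N -> forall i, x k.+1 i 0 = 1.
  (* The shift by one reflects that an entry becomes exactly 1 one update after the iterate is close
     to 1. *)
  by exists K.+1 => -[|k] // Kk; apply/colP => i; rewrite mxE KP.
apply: eventually_forall_ord => i.
(* A tolerance of [(u i 0 + 1) / M] lowers the weighted sum by at most [u i 0 + 1], so the argument
   of [sat] stays at least [- (u i 0 + 1) + 2 + u i 0 = 1]. *)
have d_gt0 : 0 < u i 0 + 1 by have := u_gt i; lra.
have dM_gt0 : 0 < (u i 0 + 1) / M by rewrite divr_gt0.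
have [K KP] := ysup_approx dM_gt0.
exists K => k Kk; rewrite x_rec updateE; apply: sat_eq1.
have x_near1 j : (const_mx 1 : 'cV[R]_n) j 0 <= x k j 0 + (u i 0 + 1) / M.
  rewrite mxE; apply: le_trans (ysup_ge1 j) _.
  by apply: le_trans (KP k Kk j) _; rewrite lerD2r.
have := mul_le i (ltW dM_gt0) x_near1.
rewrite mulrCA divff ?mulr1 ?gt_eqF // big1 => [|j _]; first lra.
by rewrite mxE subrr mulr0.
Qed.

End MonotoneIteration.

(** With row sum [r >= 1], the argument of [sat] is [-2 r + 2 - 1 <= -1]. *)
Lemma update_constN1 (R : realType) (n : nat) (A : 'M[R]_n) :
  (forall i, 1 <= \sum_j A i j) ->
  const_mx (-1) = update A (const_mx (-1)) (const_mx (-1)).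
Proof.
move=> row_ge1; apply/colP => i; rewrite updateE !mxE sat_eqN1 //.
under eq_bigr do rewrite mxE.
by rewrite -mulr_suml; have := row_ge1 i; lra.
Qed.

(** * Combinatorics of the absorbing set and its matrices *)

Section AbsorbingSet.

Variables (V C : choiceType) (nbr : V -> {fset C}) (D : {fset V}).

Lemma card_nbr_even_odd v : v \in D ->
  #|` nbr v| = (#|` nbr v `&` evenCN nbr D| + #|` nbr v `&` oddCN nbr D|)%N.
Proof.
move=> vD.
have nbr_adj c : c \in nbr v -> c \in adjacentCN nbr D.
  by move=> cv; apply/bigfcupP; exists v => //; rewrite vD.
rewrite -(cardfsID (evenCN nbr D)); congr (_ + #|` _|)%N.
apply/fsetP => c; rewrite !inE.
case: (boolP (c \in nbr v)) => [/nbr_adj ->|]; last by rewrite andbF.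
by rewrite /= andbT negbK.
Qed.

(** A strict majority among three neighbors means at least two even ones, so one survives the
    removal of [c]. *)
Lemma even_neighbor_exchange v c : #|` nbr v| = 3%N -> v \in D ->
  (#|` nbr v `&` oddCN nbr D| < #|` nbr v `&` evenCN nbr D|)%N ->
  exists2 c', c' \in nbr v `&` evenCN nbr D & c != c'.
Proof.
move=> card3 vD lt_odd_even.
have := card_nbr_even_odd vD; rewrite card3 => card_split.
have : (0 < #|` (nbr v `&` evenCN nbr D) `\ c|)%N.
  have := cardfsD1 c (nbr v `&` evenCN nbr D); case: (_ \in _) => /=; lia.
rewrite cardfs_gt0 => /fset0Pn[c']; rewrite in_fsetD1 => /andP[c'c c'E].
by exists c'; rewrite // eq_sym.
Qed.

(** The number of connections is even, and positive because of [v], hence at least two. *)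
Lemma evenCN_other_neighbor v c : v \in D -> c \in nbr v ->
  c \in evenCN nbr D -> exists v', [/\ v' \in D, c \in nbr v' & v' != v].
Proof.
move=> vD cv; rewrite !inE => /andP[_]; rewrite /connections => even_c.
set S := [fset _ in _ | _] in even_c.
have vS : v \in S by rewrite !inE vD.
have : (0 < #|` S `\ v|)%N.
  by move: even_c; rewrite (cardfsD1 v S) vS; case: #|` _|.
rewrite cardfs_gt0 => /fset0Pn[v']; rewrite !inE => /andP[v'v /andP[v'D cv']].
by exists v'.
Qed.

Variables (R : realType) (a b N : nat) (msg : 'I_N -> V * C).
Hypothesis degree3 : forall v, #|` nbr v| = 3%N.
Hypothesis D_absorbing : absorbing_set nbr D a b.
Hypothesis msg_enum : enumerates msg (internal_message nbr D).

Lemma internal_message_exists : inhabited 'I_N.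
Proof.
case: D_absorbing => /fset0Pn[v vD] _ _ /(_ v vD) lt_odd_even.
have : (0 < #|` nbr v `&` evenCN nbr D|)%N by case: #|` _ `&` evenCN _ _| lt_odd_even.
rewrite cardfs_gt0 => /fset0Pn[c]; rewrite in_fsetI => /andP[cv cE].
have [|i _] := (proj1 (proj2 msg_enum (v, c))); last by exists.
by rewrite /internal_message /= vD cv cE.
Qed.

Lemma routing_mx_ge0 i j : 0 <= routing_mx R nbr msg i j.
Proof. by rewrite mxE ler0n. Qed.

(** The message from [v] to [c] is fed by at least one other: [v] has a second even check node [c'],
    and [c'] has a second neighbor [v'] in [D]. *)
Lemma routing_mx_row_ge1 i : 1 <= \sum_j routing_mx R nbr msg i j.
Proof.
have /and3P[vD cE cv] : internal_message nbr D (msg i).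
  by apply/(proj2 msg_enum); exists i.
have [_ _ _ /(_ _ vD) lt_odd_even] := D_absorbing.
have [c' c'vE cc'] :=
  even_neighbor_exchange (msg i).2 (degree3 _) vD lt_odd_even.
move: c'vE; rewrite in_fsetI => /andP[c'v c'E].
have [v' [v'D c'v' v'v]] := evenCN_other_neighbor vD c'v c'E.
have [|j msgj] := (proj1 (proj2 msg_enum (v', c'))).
  by rewrite /internal_message /= v'D c'v' c'E.
rewrite (bigD1 j) //= mxE msgj /= v'v c'v' c'v cc' lerDl.
by apply: sumr_ge0 => k _; apply: routing_mx_ge0.
Qed.

(** Since [vn] enumerates [D] without repetition, each row of the repetition matrix has a single
    1. *)
Lemma repetition_mxE (vn : 'I_a -> V) (i : 'I_N) :
  enumerates vn (fun v => v \in D) ->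
  exists w : 'I_a, forall l : 'cV[R]_a,
    (repetition_mx R msg vn *m l) i 0 = l w 0.
Proof.
move=> [vn_inj vn_surj].
have /and3P[vD _ _] : internal_message nbr D (msg i).
  by apply/(proj2 msg_enum); exists i.
have [w vnw] := (proj1 (vn_surj _)) vD; exists w => l.
rewrite mxE (bigD1 w) //= mxE vnw eqxx mul1r big1 ?addr0 // => w' w'w.
rewrite mxE -vnw; case: eqP => [/vn_inj ww'|]; last by rewrite mul0r.
by rewrite ww' eqxx in w'w.
Qed.

End AbsorbingSet.

(** * Comparison with the optimum *)

Lemma objective_values_N1 (R : realType) (n m : nat) (A : 'M[R]_n)
    (L : 'cV[R]_m -> 'cV[R]_n) (i0 : 'I_n) (j0 : 'I_m) :
  (forall i, 1 <= \sum_j A i j) -> L (const_mx (-1)) = const_mx (-1) ->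
  objective_values A L (-1).
Proof.
move=> row_ge1 LN1; exists (const_mx (-1)), (const_mx (-1)); split.
- by split=> [|i]; [exists j0|]; rewrite mxE.
- by apply: in_unit_box_const; rewrite lexx /=; lra.
- by exists i0; rewrite mxE; lra.
- by rewrite LN1; apply: update_constN1.
Qed.

(** A fixed point with an entry below 1 would make [l] feasible, with objective value above the
    maximum. The index [j0] ensures that the smallest entry exists. *)
Lemma above_max_fixed_point_ge1 (R : realType) (n m : nat) (A : 'M[R]_n)
    (L : 'cV[R]_m -> 'cV[R]_n) (tau : R) (l : 'cV[R]_m) (j0 : 'I_m) :
  is_max (objective_values A L) tau -> (forall j, tau < l j 0) ->
  forall z, in_unit_box z -> z = update A (L l) z -> forall i, 1 <= z i 0.
Proof.
move=> [_ tau_max] l_gt z z_box z_fixed i; rewrite leNgt; apply/negP => zi_lt1.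
have [t lt] := smallest_entry_exists l j0.
have /tau_max : objective_values A L t by exists l, z; split=> //; exists i.
by case: lt => -[j <-] _; rewrite leNgt l_gt.
Qed.

Theorem mainTheorem1 (R : realType) (V C : choiceType) (nbr : V -> {fset C})
    (degree3 : forall v : V, #|` nbr v| = 3%N)
    (D : {fset V}) (a b : nat)
    (D_absorbing : absorbing_set nbr D a b)
    (D_elementary : elementary nbr D)
    (N : nat) (N_def : N = (2 * #|` evenCN nbr D|)%N)
    (msg : 'I_N -> V * C) (msg_enum : enumerates msg (internal_message nbr D))
    (vn : 'I_a -> V) (vn_enum : enumerates vn (fun v => v \in D))
    (A : 'M[R]_N) (A_def : A = routing_mx R nbr msg)
    (Rep : 'M[R]_(N, a)) (Rep_def : Rep = repetition_mx R msg vn)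
    (tau : R)
    (tau_sol : is_max (objective_values A (fun l : 'cV[R]_a => Rep *m l)) tau \/
               is_max (objective_values A (fun l : 'cV[R]_N => l)) tau)
    (lambda : 'cV[R]_a) (lambda_gt : forall i : 'I_a, tau < lambda i 0)
    (x : nat -> 'cV[R]_N) (x0_box : in_unit_box (x 0%N))
    (x_rec : forall k : nat, x k.+1 = update A (Rep *m lambda) (x k)) :
  exists K : nat, forall k : nat, (K <= k)%N -> x k = const_mx 1.
Proof.
subst A Rep; set A := routing_mx R nbr msg; set Rep := repetition_mx R msg vn.
have [i0] := internal_message_exists D_absorbing msg_enum.
have RepE i := @repetition_mxE _ _ _ _ R _ _ _ msg_enum vn i vn_enum.
have [w0 _] := RepE i0.
have row_ge1 := routing_mx_row_ge1 R degree3 D_absorbing msg_enum.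
have Rep_gt i : tau < (Rep *m lambda) i 0 by have [w ->] := RepE i.
have RepN1 : Rep *m const_mx (-1) = const_mx (-1) :> 'cV_N.
  by apply/colP => i; have [w ->] := RepE i; rewrite !mxE.
have tau_geN1 : -1 <= tau.
  by case: tau_sol => -[_]; apply; apply: objective_values_N1.
apply: iterates_eventually_one x0_box x_rec.
- exact: routing_mx_ge0.
- by move=> i; apply: le_lt_trans (Rep_gt i).
(* For the problem over [R^a] the competitor is [lambda] itself; for the one over [R^N] it is
   [Rep *m lambda], whose entries are entries of [lambda]. *)
case: tau_sol => tau_max.
- exact: above_max_fixed_point_ge1 tau_max lambda_gt.
- exact: above_max_fixed_point_ge1 i0 tau_max Rep_gt.
Qed.
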